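(* Let $n\ge 2$ and let $\Sigma$ be a complete oriented $f$-minimal hypersurface properly immersed in the cylinder shrinking soliton $(\mathbb{S}^{n}(\sqrt{2(n-1)})\times\mathbb{R},\overline{g}, f)$. Then $\Sigma$ is totally geodesic if and only if it is either $\mathbb{S}^n(\sqrt{2(n-1)})\times\{0\}$ or $\mathbb{S}^{n-1}(\sqrt{2(n-1)})\times\mathbb{R}$, where $\mathbb{S}^{n-1}(\sqrt{2(n-1)})$ denotes a totally geodesic $(n-1)$-sphere of $\mathbb{S}^{n}(\sqrt{2(n-1)})$.
   Context: $\mathbb{S}^n(r)$ is the round sphere of radius $r$ in $\mathbb{R}^{n+1}$ centered at the origin. The cylinder shrinking soliton $(\mathbb{S}^{n}(\sqrt{2(n-1)})\times\mathbb{R},\overline g,f)$ is the product manifold with the product metric $\overline g=g_{\mathbb{S}^n(\sqrt{2(n-1)})}+dh^2$ and the function $f(x,h)=h^2/4$, where $h$ is the coordinate on $\mathbb{R}$. Let $\Sigma$ be an $n$-dimensional oriented hypersurface isometrically immersed in this space, with unit normal $\nu$. As usual, manifolds are connected, and ''complete'' means complete in the induced metric. The second fundamental form is $A(X,Y)=\langle\overline\nabla_X\nu,Y\rangle$, and the mean curvature is $H=\mathrm{tr}\,A$, where $\overline\nabla$ is the ambient Levi-Civita connection. $\Sigma$ is $f$-minimal if $H=\langle\overline\nabla f,\nu\rangle$ on $\Sigma$, and totally geodesic if $A\equiv0$. *)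

(* Defs.v *)
From HB Require Import structures.
From mathcomp Require Import all_boot all_order all_algebra.
From mathcomp Require Import all_classical all_reals all_analysis.
Set Implicit Arguments.
Unset Strict Implicit.
Unset Printing Implicit Defensive.
Import Order.TTheory GRing.Theory Num.Theory numFieldNormedType.Exports.
Local Open Scope classical_set_scope.
Local Open Scope ring_scope.

(* The library norm on 'rV[R]_k is the sup norm: it is used only for its
   topology and for derivatives; all metric notions below come from [dot]. *)
Definition dot (R : realType) (k : nat) (u v : 'rV[R]_k) : R :=
  \sum_i u 0 i * v 0 i.

(* k is the dimension of the surrounding Euclidean space:
   [@sphere R k r] is the round (k-1)-sphere S^(k-1)(r). *)
Definition sphere (R : realType) (k : nat) (r : R) : set 'rV[R]_k :=
  [set y | Num.sqrt (dot y y) = r].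

(** Smooth maps between open subsets of normed spaces *)

Definition iter_derive (R : realType) (k : nat) (V : normedModType R)
    (f : 'rV[R]_k -> V) (vs : seq 'rV[R]_k) : 'rV[R]_k -> V :=
  foldr (fun v (g : 'rV[R]_k -> V) y => 'D_v g y) f vs.

(* C^infinity on the open set U: f and all its iterated directional
   derivatives are Frechet differentiable at every point of U. *)
Definition smooth_on (R : realType) (k : nat) (V : normedModType R)
    (U : set 'rV[R]_k) (f : 'rV[R]_k -> V) : Prop :=
  forall vs y, U y -> differentiable (iter_derive f vs) y.

(** Smooth manifolds *)

(* Charts are total maps in both directions, with junk values outside
   [dom] and outside its image. *)
Record chart (R : realType) (n : nat) (M : topologicalType) := Chart {
  dom : set M;
  cmap : M -> 'rV[R]_n;
  cinv : 'rV[R]_n -> M;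
  dom_open : open dom;
  cod_open : open (cmap @` dom);
  cmap_continuous : {within dom, continuous cmap};
  cinv_continuous : {within cmap @` dom, continuous cinv};
  cmapK : forall p, dom p -> cinv (cmap p) = p }.

Record manifold (R : realType) (n : nat) := Manifold {
  carrier :> topologicalType;
  atlas : set (chart R n carrier);
  manifold_hausdorff : hausdorff_space carrier;
  manifold_countable : @second_countable carrier;
  manifold_nonempty : [set: carrier] !=set0;
  manifold_connected : connected [set: carrier];
  atlas_cover : forall p, exists2 c, atlas c & dom c p;
  atlas_smooth : forall c d, atlas c -> atlas d ->
    smooth_on [set y | (cmap c @` dom c) y /\ dom d (cinv c y)]
              (cmap d \o cinv c) }.

Definition smooth_map (R : realType) (n : nat) (M : manifold R n)
    (V : normedModType R) (F : M -> V) : Prop :=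
  forall c, atlas c -> smooth_on (cmap c @` dom c) (F \o cinv c).

(* The derivative at p of F along the tangent vector whose coordinates in the
   chart c are v. *)
Definition tderive (R : realType) (n : nat) (M : manifold R n)
    (V : normedModType R) (F : M -> V) (c : chart R n M) (p : M)
    (v : 'rV[R]_n) : V :=
  'D_v (F \o cinv c) (cmap c p).

(** The cylinder S^n(r) x R inside R^(n+1) x R *)

Notation ambient R n := ('rV[R]_n.+1 * R^o)%type.

Definition cylinder (R : realType) (n : nat) (r : R) : set (ambient R n) :=
  @sphere R n.+1 r `*` setT.

Definition metric (R : realType) (n : nat) (v w : ambient R n) : R :=
  dot v.1 w.1 + v.2 * w.2.

(* Orthogonal projection onto the tangent space at y of the sphere centered at
   the origin through y. *)
Definition sphere_proj (R : realType) (k : nat) (y v : 'rV[R]_k) : 'rV[R]_k :=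
  v - (dot y v / dot y y) *: y.

(* Orthogonal projection onto the tangent space of the cylinder at q. *)
Definition tproj (R : realType) (n : nat) (q v : ambient R n) : ambient R n :=
  (sphere_proj q.1 v.1, v.2).

(* The gradient on the cylinder is the tangential part of the Euclidean
   gradient. *)
Definition grad (R : realType) (n : nat) (f : ambient R n -> R^o)
    (q : ambient R n) : ambient R n :=
  tproj q (\row_i 'D_((delta_mx 0 i, 0) : ambient R n) f q,
           'D_((0, 1) : ambient R n) f q).

Definition potential (R : realType) (n : nat) (q : ambient R n) : R^o :=
  q.2 ^+ 2 / 4.

(** Immersed hypersurfaces of the cylinder, with the induced metric *)

Definition immersed_hypersurface (R : realType) (n : nat) (r : R)
    (M : manifold R n) (x : M -> ambient R n) : Prop :=
  [/\ forall p, cylinder r (x p),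
      smooth_map x
    & forall c p, atlas c -> dom c p -> injective (tderive x c p)].

(* The cylinder being orientable, an orientation of the hypersurface amounts to
   the choice of a global unit normal field. *)
Definition unit_normal (R : realType) (n : nat) (M : manifold R n)
    (x nu : M -> ambient R n) : Prop :=
  [/\ smooth_map nu,
      forall p, dot (x p).1 (nu p).1 = 0,
      forall p, metric (nu p) (nu p) = 1
    & forall c p v, atlas c -> dom c p ->
        metric (nu p) (tderive x c p v) = 0].

Definition properly_immersed (R : realType) (n : nat) (r : R)
    (M : manifold R n) (x : M -> ambient R n) : Prop :=
  forall K : set (ambient R n), K `<=` cylinder r -> compact K ->
    compact (x @^-1` K).

(* Covariant derivative, for the Levi-Civita connection of the cylinder, of a
   field V along x: for a submanifold of a Euclidean space it is the
   tangential part of the flat derivative. *)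
Definition covariant_derive (R : realType) (n : nat) (M : manifold R n)
    (x V : M -> ambient R n) (c : chart R n M) (p : M) (u : 'rV[R]_n) :
    ambient R n :=
  tproj (x p) (tderive V c p u).

Definition second_form (R : realType) (n : nat) (M : manifold R n)
    (x nu : M -> ambient R n) (c : chart R n M) (p : M) (u v : 'rV[R]_n) : R :=
  metric (covariant_derive x nu c p u) (tderive x c p v).

Definition first_form (R : realType) (n : nat) (M : manifold R n)
    (x : M -> ambient R n) (c : chart R n M) (p : M) (u v : 'rV[R]_n) : R :=
  metric (tderive x c p u) (tderive x c p v).

(* Trace of the second fundamental form with respect to the induced metric,
   g^(ij) A_(ij) in the chart c. *)
Definition mean_curvature (R : realType) (n : nat) (M : manifold R n)
    (x nu : M -> ambient R n) (c : chart R n M) (p : M) : R :=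
  \tr (invmx (\matrix_(i < n, j < n)
                first_form x c p (delta_mx 0 i) (delta_mx 0 j))
       *m (\matrix_(i < n, j < n)
                second_form x nu c p (delta_mx 0 i) (delta_mx 0 j))).

Definition f_minimal (R : realType) (n : nat) (f : ambient R n -> R^o)
    (M : manifold R n) (x nu : M -> ambient R n) : Prop :=
  forall c p, atlas c -> dom c p ->
    mean_curvature x nu c p = metric (grad f (x p)) (nu p).

Definition totally_geodesic (R : realType) (n : nat)
    (M : manifold R n) (x nu : M -> ambient R n) : Prop :=
  forall c p u v, atlas c -> dom c p -> second_form x nu c p u v = 0.

(** Completeness of the Riemannian distance *)

(* Only the restriction to [0, 1] matters; a C^1 curve on [0, 1] extends, up to
   that restriction, to the whole line. *)
Definition C1_curve (R : realType) (n : nat) (M : manifold R n) (g : R -> M) :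
    Prop :=
  continuous g /\
  forall c t, atlas c -> dom c (g t) ->
    derivable (cmap c \o g) t 1 /\ {for t, continuous (derive1 (cmap c \o g))}.

(* In the induced metric the norm of g' is the norm of (x o g)'. *)
Definition curve_length (R : realType) (n : nat) (M : manifold R n)
    (x : M -> ambient R n) (g : R -> M) : \bar R :=
  \int[lebesgue_measure]_(t in `[0, 1])
    (Num.sqrt (metric (derive1 (x \o g) t) (derive1 (x \o g) t)))%:E.

(* Piecewise C^1 curves from p to q, as lists of C^1 pieces over [0, 1]. *)
Fixpoint joins (R : realType) (n : nat) (M : manifold R n)
    (p : M) (gs : seq (R -> M)) (q : M) : Prop :=
  if gs is g :: gs' then [/\ C1_curve g, g 0 = p & joins (g 1) gs' q]
  else p = q.

Definition riemannian_dist (R : realType) (n : nat) (M : manifold R n)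
    (x : M -> ambient R n) (p q : M) : \bar R :=
  ereal_inf [set (\sum_(g <- gs) curve_length x g)%E | gs in
               [set gs | joins p gs q]].

Definition complete_hypersurface (R : realType) (n : nat) (M : manifold R n)
    (x : M -> ambient R n) : Prop :=
  forall s : nat -> M,
    (forall e : R, 0 < e -> exists N, forall i j, (N <= i)%N -> (N <= j)%N ->
       (riemannian_dist x (s i) (s j) < e%:E)%E) ->
    exists p, forall e : R, 0 < e -> exists N, forall i, (N <= i)%N ->
       (riemannian_dist x (s i) p < e%:E)%E.

(** Totally geodesic (n-1)-spheres of S^n(r) *)

(* S is the image of an isometric embedding i of S^(n-1)(r) into S^n(r), with
   unit normal N, whose second fundamental form vanishes; i and N are given by
   smooth extensions to a neighborhood of S^(n-1)(r) in R^n, and u, v range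
   over vectors tangent to S^(n-1)(r). *)
Definition totally_geodesic_sphere (R : realType) (n : nat) (r : R)
    (S : set 'rV[R]_n.+1) : Prop :=
  exists (U : set 'rV[R]_n) (i N : 'rV[R]_n -> 'rV[R]_n.+1),
    [/\ open U, @sphere R n r `<=` U, smooth_on U i & smooth_on U N] /\
    [/\ set_inj (@sphere R n r) i,
        i @` @sphere R n r = S,
        forall y, sphere r y ->
          [/\ sphere r (i y), dot (i y) (N y) = 0 & dot (N y) (N y) = 1],
        forall y u, sphere r y -> dot y u = 0 -> dot (N y) ('D_u i y) = 0
      & forall y u v, sphere r y -> dot y u = 0 -> dot y v = 0 ->
          dot ('D_u i y) ('D_v i y) = dot u v /\
          dot (sphere_proj (i y) ('D_u N y)) ('D_v i y) = 0].

(* Main.v *)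
Require Import Defs.
From HB Require Import structures.
From mathcomp Require Import all_boot all_order all_algebra.
From mathcomp Require Import all_classical all_reals all_analysis.
From mathcomp Require Import ring lra.
Set Implicit Arguments.
Unset Strict Implicit.
Unset Printing Implicit Defensive.
Import Order.TTheory GRing.Theory Num.Theory numFieldNormedType.Exports.
Local Open Scope classical_set_scope.
Local Open Scope ring_scope.

(** Points of the cylinder are written (x_1, h), with x_1 on the sphere and h
    the height; the normal field is nu = (nu_1, nu_h).

    Let the hypersurface be totally geodesic. The tangential part of the
    derivative of nu vanishes, so that this derivative is a multiple of
    (x_1, 0); the factor is nu_h dh / r^2, because <x_1, nu_1> = 0
    ([second_form0_derive_normal]). In particular nu_h is constant. The
    equation of f-minimality reduces to h nu_h = 0, whence nu_h dh = 0, and nu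
    is a constant vector (N, a) of R^(n+2)
    ([totally_geodesic_constant_normal]). The hypersurface thus lies in the
    slice of the cylinder defined by <x_1, N> = 0 and h a = 0.

    It fills that slice ([range_constant_normal]): given a point q of the slice,
    properness yields a point of the hypersurface minimizing
    |x_1 - q_1|^2 + K (h - q_h)^2. At the minimum the vector
    (x_1 - q_1, K (h - q_h)) is normal to the hypersurface; being orthogonal to
    nu it is a multiple of (x_1, 0), by a count of dimensions
    ([normal_decomposition]). Hence h = q_h and x_1 is q_1 or - q_1, and a small
    weight K excludes the antipode. This argument avoids the inverse function
    theorem and uses only first derivatives. If a = 0 the slice is the product
    of a hyperplane section of the sphere with the line; otherwise h = 0 forces
    N = 0 and the slice is the horizontal sphere.

    Conversely, if a constant unit vector is tangent to the cylinder and normal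
    to the hypersurface at every point, then nu is that vector up to a constant
    sign, and its derivative vanishes
    ([constant_unit_normal_totally_geodesic]). For the horizontal sphere this
    vector is vertical. For the product of a totally geodesic sphere with the
    line, it comes from the unit normal of that sphere, which is parallel, hence
    constant along great circles
    ([totally_geodesic_sphere_orthogonal]). *)

(** * Euclidean linear algebra *)

Section LinearAlgebra.
Variable R : realType.

Lemma dotE k (u v : 'rV[R]_k) : dot u v = (u *m v^T) 0 0.
Proof. by rewrite mxE; apply: eq_bigr => i _; rewrite mxE. Qed.

Lemma dotC k (u v : 'rV[R]_k) : dot u v = dot v u.
Proof. by apply: eq_bigr => i _; rewrite mulrC. Qed.

Lemma dotDl k (u v w : 'rV[R]_k) : dot (u + v) w = dot u w + dot v w.
Proof. by rewrite !dotE mulmxDl mxE. Qed.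

Lemma dotZl k a (u v : 'rV[R]_k) : dot (a *: u) v = a * dot u v.
Proof. by rewrite !dotE -scalemxAl mxE. Qed.

Lemma dotNl k (u v : 'rV[R]_k) : dot (- u) v = - dot u v.
Proof. by rewrite -scaleN1r dotZl mulN1r. Qed.

Lemma dotBl k (u v w : 'rV[R]_k) : dot (u - v) w = dot u w - dot v w.
Proof. by rewrite dotDl dotNl. Qed.

Lemma dotDr k (u v w : 'rV[R]_k) : dot u (v + w) = dot u v + dot u w.
Proof. by rewrite dotC dotDl !(dotC u). Qed.

Lemma dotZr k a (u v : 'rV[R]_k) : dot u (a *: v) = a * dot u v.
Proof. by rewrite dotC dotZl dotC. Qed.

Lemma dotNr k (u v : 'rV[R]_k) : dot u (- v) = - dot u v.
Proof. by rewrite dotC dotNl dotC. Qed.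

Lemma dotBr k (u v w : 'rV[R]_k) : dot u (v - w) = dot u v - dot u w.
Proof. by rewrite dotDr dotNr. Qed.

Lemma dot0l k (u : 'rV[R]_k) : dot 0 u = 0.
Proof. by rewrite -[0](scale0r 0) dotZl mul0r. Qed.

Lemma dot0r k (u : 'rV[R]_k) : dot u 0 = 0.
Proof. by rewrite dotC dot0l. Qed.

Definition dot_simpl := (dotDl, dotBl, dotNl, dotZl, dotDr, dotBr, dotNr, dotZr,
  dot0l, dot0r).

Lemma dot_ge0 k (u : 'rV[R]_k) : 0 <= dot u u.
Proof. by apply: sumr_ge0 => i _; rewrite -expr2 sqr_ge0. Qed.

Lemma dot_eq0 k (u : 'rV[R]_k) : (dot u u == 0) = (u == 0).
Proof.
apply/idP/eqP => [|->]; last by rewrite dot0l.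
rewrite psumr_eq0 => [/allP u0|i _]; last by rewrite -expr2 sqr_ge0.
apply/rowP => i; rewrite mxE; apply/eqP.
by have := u0 i (mem_index_enum _); rewrite /= mulf_eq0 orbb.
Qed.

Lemma sphereP k (r : R) (y : 'rV[R]_k) : 0 <= r ->
  sphere r y <-> dot y y = r ^+ 2.
Proof.
move=> r0; split=> [<-|]; first by rewrite sqr_sqrtr ?dot_ge0.
by rewrite /sphere /= => ->; rewrite sqrtr_sqr ger0_norm.
Qed.

Lemma dot_row_mx k l (u v : 'rV[R]_k) (w z : 'rV[R]_l) :
  dot (row_mx u w) (row_mx v z) = dot u v + dot w z.
Proof. by rewrite !dotE tr_row_mx mul_row_col mxE. Qed.

(** The tangent spaces of a hypersurface of the sphere, and of a hypersurface of
    the cylinder, have codimension two in the surrounding Euclidean space. This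
    count of dimensions is what turns the vanishing of a second fundamental
    form into a formula for the derivative of the normal. *)
Lemma orthogonal_pair_complement k m (A : 'M[R]_(k, m)) (a b u : 'rV[R]_m) :
  m = (k + 2)%N -> row_free A -> a != 0 -> b != 0 -> dot a b = 0 ->
  (forall v : 'rV[R]_k, dot a (v *m A) = 0) ->
  (forall v : 'rV[R]_k, dot b (v *m A) = 0) ->
  (forall v : 'rV[R]_k, dot u (v *m A) = 0) ->
  exists s t, u = s *: a + t *: b.
Proof.
move=> mk freeA a0 b0 ab aA bA uA.
have ker w : (forall v : 'rV[R]_k, dot w (v *m A) = 0) -> (w <= kermx A^T)%MS.
  move=> wA; apply/sub_kermxP/rowP => i; rewrite [RHS]mxE.
  (* An entry of w A^T is the product of w with a row of A. *)
  rewrite -(wA (delta_mx 0 i)) dotE trmx_mul mulmxA.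
  by rewrite trmx_delta -colE [RHS]mxE.
pose B := col_mx a b.
have vB (v : 'rV[R]_(1 + 1)) :
    v *m B = lsubmx v 0 0 *: a + rsubmx v 0 0 *: b.
  by rewrite -{1}[v]hsubmxK mul_row_col {1}[lsubmx v]mx11_scalar
    {1}[rsubmx v]mx11_scalar !mul_scalar_mx.
have freeB : row_free B.
  apply: inj_row_free => v; rewrite vB => v0.
  have := congr1 (dot a) v0; have := congr1 (dot b) v0.
  rewrite !dot_simpl dotC ab !mulr0 add0r addr0.
  move/eqP; rewrite mulf_eq0 dot_eq0 (negbTE b0) orbF => /eqP vb.
  move/eqP; rewrite mulf_eq0 dot_eq0 (negbTE a0) orbF => /eqP va.
  rewrite -[v]hsubmxK [lsubmx v]mx11_scalar [rsubmx v]mx11_scalar va vb.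
  by rewrite !raddf0 row_mx0.
have BA : (B <= kermx A^T)%MS by rewrite col_mx_sub !ker.
have : (B == kermx A^T)%MS.
  rewrite -(geq_leqif (mxrank_leqif_eq BA)) mxrank_ker mxrank_tr.
  by rewrite (eqP freeA) (eqP freeB) mk addKn.
case/andP=> _ /(submx_trans (ker _ uA)) /submxP[D ->].
by rewrite vB; do 2!eexists.
Qed.

Lemma ex_orthogonal_neq0 n (y : 'rV[R]_n) : (2 <= n)%N ->
  exists2 w : 'rV[R]_n, w != 0 & dot y w = 0.
Proof.
move=> n2; have : (0 < \rank (kermx y^T))%N.
  rewrite mxrank_ker mxrank_tr subn_gt0 (leq_ltn_trans (rank_leq_row y))//.
rewrite lt0n mxrank_eq0 => /rowV0Pn[w /sub_kermxP wy w0]; exists w => //.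
by rewrite dotC dotE wy mxE.
Qed.

End LinearAlgebra.

(** * Directional derivatives *)

Section Calculus.
Variable R : realType.

Lemma is_derive_comp (V W : normedModType R) (g : V -> W) (f : R -> V) (t : R)
    (df : V) :
  differentiable g (f t) -> is_derive t 1 f df ->
  is_derive t 1 (g \o f) ('D_df g (f t)).
Proof.
move=> dg [/derivable1_diffP dft <-].
split; first exact/derivable1_diffP/differentiable_comp.
rewrite deriveE; last exact: differentiable_comp.
by rewrite diff_comp //= -deriveE // -deriveE.
Qed.

Lemma is_derive_linear (U V W : normedModType R) (L : {linear V -> W})
    (f : U -> V) a v df :
  continuous L -> is_derive a v f df -> is_derive a v (L \o f) (L df).
Proof.
move=> cL [dfa dfE].
suff h : (fun h => h^-1 *: (((L \o f) \o shift a) (h *: v) - (L \o f) a))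
    @ 0^' --> L df.
  by split; [by apply/cvg_ex; exists (L df)|exact: cvg_lim h].
rewrite [X in X @ _ --> _](_ : _ =
  L \o (fun h => h^-1 *: ((f \o shift a) (h *: v) - f a))); last first.
  by apply/funext => h /=; rewrite linearZ_LR (raddfB L).
apply: continuous_cvg; first exact: cL.
by rewrite -dfE; apply: dfa.
Qed.

Lemma is_derive_fst (U V W : normedModType R) (f : U -> V * W) a v df :
  is_derive a v f df -> is_derive a v (fun x => (f x).1) df.1.
Proof.
move=> Df; apply: (@is_derive_linear _ _ _ (@fst V W) f) Df => x.
exact: cvg_fst.
Qed.

Lemma is_derive_snd (U V W : normedModType R) (f : U -> V * W) a v df :
  is_derive a v f df -> is_derive a v (fun x => (f x).2) df.2.
Proof.
move=> Df; apply: (@is_derive_linear _ _ _ (@snd V W) f) Df => x.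
exact: cvg_snd.
Qed.

Lemma is_derive_coord (V : normedModType R) k (f : V -> 'rV[R]_k) a v df j :
  is_derive a v f df -> is_derive a v (fun x => f x 0 j) (df 0 j).
Proof.
move=> [dfa dfE]; split; first by move/derivable_mxP : dfa; apply.
by rewrite -dfE derive_mx// mxE.
Qed.

Lemma is_derive_dot (V : normedModType R) k (f g : V -> 'rV[R]_k) a v df dg :
  is_derive a v f df -> is_derive a v g dg ->
  is_derive a v (fun x => dot (f x) (g x)) (dot df (g a) + dot (f a) dg).
Proof.
move=> Df Dg.
rewrite (_ : (fun x => dot (f x) (g x)) =
    \sum_(i < k) (fun x => f x 0 i) * (fun x => g x 0 i)); last first.
  by apply/funext => x; rewrite /dot fct_sumE.
apply: is_derive_eq.
  apply: is_derive_sum => i.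
  by apply: is_deriveM; apply: is_derive_coord; eassumption.
rewrite -big_split; apply: eq_bigr => i _ /=.
by rewrite addrC ![_ *: _]mulrC [dg 0 i * _]mulrC.
Qed.

Lemma is_derive_unique (V W : normedModType R) (f : V -> W) a v d d' :
  is_derive a v f d -> is_derive a v f d' -> d = d'.
Proof. by move=> [_ <-] [_ <-]. Qed.

Lemma is_derive_line (V W : normedModType R) (f : V -> W) (a v : V) (t : R)
    df :
  is_derive (t *: v + a) v f df ->
  is_derive t 1 (fun s : R => f (s *: v + a)) df.
Proof.
move=> [dfa dfE].
suff E : (fun h : R =>
      h^-1 *: (((fun s : R => f (s *: v + a)) \o shift t) (h *: 1)
        - f (t *: v + a))) =
    (fun h => h^-1 *: ((f \o shift (t *: v + a)) (h *: v) - f (t *: v + a))).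
  by split; rewrite /derivable ?derive_val -?dfE /derive E.
by apply/funext => h /=; rewrite scalerDl -addrA [_%:A]mulr1.
Qed.

(** Fermat's rule for the restriction of f to the line through a along v. *)
Lemma derive_at_min (V : normedModType R) (f : V -> R^o) a v :
  (\forall b \near a, derivable f b v) -> (forall b, f a <= f b) ->
  'D_v f a = 0.
Proof.
move=> dfa fmin; pose l (t : R) := t *: v + a.
have l0 : l 0 = a by rewrite /l scale0r add0r.
have cl : l @ 0 --> a.
  rewrite -[in X in _ --> X]l0; apply: cvgD; last exact: cvg_cst.
  exact: scalel_continuous.
have /nbhs_ballP[e /= e0 dl] : \forall t \near (0 : R), derivable f (l t) v.
  by move: cl => /(_ _ dfa).
have Dl t : t \in `]- e, e[%R -> is_derive t 1 (f \o l) ('D_v f (l t)).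
  move=> te; apply: is_derive_line; apply/derivableP.
  apply: dl; rewrite /ball /= sub0r normrN ltr_norml.
  by move: te; rewrite in_itv.
have e00 : (0 : R) \in `]- e, e[%R by rewrite in_itv /= oppr_lt0 e0.
have := Dl 0 e00; rewrite l0 => /is_derive_unique; apply.
apply: derive1_at_min e00 _; first by rewrite ge0_cp ?ltW.
  by move=> t /Dl[].
by move=> t _ /=; rewrite l0.
Qed.

Lemma cvg_dot (T : Type) (F : set_system T) {FF : Filter F} k
    (f g : T -> 'rV[R]_k) (u v : 'rV[R]_k) :
  f @ F --> u -> g @ F --> v -> dot (f t) (g t) @[t --> F] --> dot u v.
Proof.
move=> fu gv; apply: cvg_big => [|i _]; first exact: add_continuous.
apply: cvgM.
  apply: (@cvg_comp _ _ _ f (fun w : 'rV[R]_k => w 0 i) _ _ _ fu).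
  exact: coord_continuous.
apply: (@cvg_comp _ _ _ g (fun w : 'rV[R]_k => w 0 i) _ _ _ gv).
  exact: coord_continuous.
Qed.

Lemma is_derive_metric (V : normedModType R) n (f g : V -> ambient R n)
    a v df dg :
  is_derive a v f df -> is_derive a v g dg ->
  is_derive a v (fun x => metric (f x) (g x))
    (metric df (g a) + metric (f a) dg).
Proof.
move=> Df Dg; apply: is_derive_eq.
  apply: is_deriveD.
    exact: is_derive_dot (is_derive_fst Df) (is_derive_fst Dg).
  exact: is_deriveM (is_derive_snd Df) (is_derive_snd Dg).
by rewrite /metric /GRing.scale /=; ring.
Qed.

Lemma compact_sphere k (r : R) : compact (@sphere R k r).
Proof.
case: (ltrP r 0) => [r0|r0].
  rewrite (_ : sphere r = set0); first exact: compact0.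
  apply/seteqP; split=> // y /= yr; have := sqrtr_ge0 (dot y y).
  by rewrite yr leNgt r0.
apply: bounded_closed_compact.
  exists r; split; first exact: num_real.
  move=> M rM y /(sphereP _ r0) yr; rewrite /Num.norm /= mx_normrE.
  apply: bigmax_le => [|[i j] _ /=]; first by rewrite (le_trans r0)// ltW.
  rewrite ord1 (le_trans _ (ltW rM))// -(@ler_pXn2r _ 2) ?nnegrE//.
  rewrite -yr /dot (bigD1 j)//= real_normK ?num_real// -expr2 lerDl.
  by apply: sumr_ge0 => l _; rewrite -expr2 sqr_ge0.
rewrite (_ : sphere r = (fun y => dot y y) @^-1` [set r ^+ 2]); last first.
  by apply/seteqP; split=> y /(sphereP _ r0).
apply: closed_comp; last exact: closed_eq.
by move=> y _; exact: (@cvg_dot _ (nbhs y) _ _ id id).  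
Qed.

End Calculus.

(** * Maps on manifolds *)

Section Manifolds.
Variables (R : realType) (n : nat) (M : manifold R n).

Lemma cmap_cvg (c : chart R n M) p :
  dom c p -> cmap c q @[q --> p] --> cmap c p.
Proof.
move=> cp; have := @cmap_continuous _ _ _ c.
rewrite continuous_open_subspace; last exact: dom_open.
by apply; rewrite inE.
Qed.

Lemma nbhs_dom (c : chart R n M) p : dom c p -> nbhs p (dom c).
Proof. by move=> cp; apply: open_nbhs_nbhs; split=> //; exact: dom_open. Qed.

Lemma nbhs_cod (c : chart R n M) p : dom c p ->
  nbhs (cmap c p) (cmap c @` dom c).
Proof.
by move=> cp; apply: open_nbhs_nbhs; split; [exact: cod_open|exists p].
Qed.

Variables (V : normedModType R) (F : M -> V).
Hypothesis smoothF : smooth_map F.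

Lemma smooth_map_differentiable (c : chart R n M) p : atlas c -> dom c p ->
  \forall y \near cmap c p, differentiable (F \o cinv c) y.
Proof.
move=> ac /nbhs_cod; apply: filterS => y.
exact: (smoothF ac [::]).
Qed.

Lemma is_tderive (c : chart R n M) p v : atlas c -> dom c p ->
  is_derive (cmap c p) v (F \o cinv c) (tderive F c p v).
Proof.
move=> ac cp; apply/derivableP/diff_derivable.
by have := nbhs_singleton (smooth_map_differentiable ac cp).
Qed.

Lemma tderive_diff (c : chart R n M) p v : atlas c -> dom c p ->
  tderive F c p v = 'd (F \o cinv c) (cmap c p) v.
Proof.
move=> ac cp; apply: deriveE.
by have := nbhs_singleton (smooth_map_differentiable ac cp).
Qed.

Lemma smooth_map_continuous : continuous F.
Proof.
move=> p; have [c ac cp] := atlas_cover p.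
have cF : F \o cinv c @ cmap c p --> F p.
  rewrite -[in F p](cmapK cp); apply: differentiable_continuous.
  by have := nbhs_singleton (smooth_map_differentiable ac cp).
suff : ((F \o cinv c) \o cmap c) q @[q --> p] --> F p.
  apply: cvg_trans; apply: near_eq_cvg.
  move/nbhs_dom : cp; apply: filterS => q cq /=.
  by rewrite cmapK.
exact: cvg_comp (cmap_cvg cp) cF.
Qed.

End Manifolds.

Lemma derive0_segment (R : realType) (f : R -> R) :
  (forall t : R, t \in `[0, 1]%R -> is_derive t 1 f 0) -> f 1 = f 0.
Proof.
move=> df; apply/eqP; rewrite -subr_eq0; apply/eqP.
have cf : {within `[0, 1], continuous f}.
  by apply: derivable_within_continuous => t /df[].
have df' (t : R) : t \in `]0, 1[%R -> is_derive t 1 f ((fun=> 0) t).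
  by move=> /subset_itv_oo_cc/df.
by have [t _ ->] := MVT_segment ler01 df' cf; rewrite mul0r.
Qed.

(** A function with zero derivative is locally constant, by the mean value
    theorem on segments of a chart, hence constant by connectedness. *)
Lemma tderive0_constant (R : realType) (n : nat) (M : manifold R n)
    (g : M -> R^o) :
  (forall c p v, atlas c -> dom c p ->
    is_derive (cmap c p) v (g \o cinv c) 0) ->
  forall p q, g p = g q.
Proof.
move=> dg0 p0 q0; pose B := [set p | g p = g p0].
have loc p : \forall q \near p, g q = g p.
  have [c ac cp] := atlas_cover p.
  have /nbhs_ballP[e /= e0 ce] : nbhs (cmap c p) (cmap c @` dom c).
    exact: nbhs_cod.
  have dp := nbhs_dom cp.
  have := cmap_cvg cp; move=> /(_ _ (nbhsx_ballx _ _ e0)) ne.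
  near=> q.
  have cq : dom c q by near: q.
  have qe : ball (cmap c p) e (cmap c q) by near: q.
  pose w := cmap c q - cmap c p.
  have we : `|w| < e by move: qe; rewrite -ball_normE /= distrC.
  pose l (t : R) := t *: w + cmap c p.
  have Dl (t : R) : t \in `[0, 1]%R -> is_derive t 1 (g \o cinv c \o l) 0.
    rewrite in_itv /= => /andP[t0 t1].
    have [z cz lz] : (cmap c @` dom c) (l t).
      apply: ce; rewrite -ball_normE /= /l opprD addrCA subrr addr0 normrN.
      by rewrite normrZ ger0_norm// (le_lt_trans _ we)// ler_piMl.
    apply: (is_derive_line (f := g \o cinv c)).
    by rewrite -/(l t) -lz; exact: dg0.
  have := derive0_segment Dl.
  by rewrite /= /l scale1r scale0r add0r subrK !cmapK.
suff : B = setT by move=> /seteqP[_ /(_ q0 I)].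
apply: (manifold_connected (m := M)); first by exists p0.
  exists B; rewrite ?setTI// openE => p Bp.
  by move: (loc p); apply: filterS => q; rewrite /B /= Bp.
exists B; rewrite ?setTI// -openC openE => p Bp.
by move: (loc p); apply: filterS => q; rewrite /B /= => ->.
Unshelve. all: by end_near. Qed.

(** * The normal plane of a hypersurface of the cylinder *)

Section NormalPlane.
Variables (R : realType) (n : nat).

Lemma metricC (v w : ambient R n) : metric v w = metric w v.
Proof. by rewrite /metric dotC mulrC. Qed.

Lemma metricDl (u v w : ambient R n) :
  metric (u + v) w = metric u w + metric v w.
Proof. by rewrite /metric /= dotDl mulrDl addrACA. Qed.

Lemma metricZl (a : R) (v w : ambient R n) : metric (a *: v) w = a * metric v w.
Proof. by rewrite /metric /= dotZl mulrDr /GRing.scale /= mulrA. Qed.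

Lemma metric_eq0 (v : ambient R n) : metric v v = 0 -> v = 0.
Proof.
case: v => u h; rewrite /metric /= -expr2 => /eqP.
rewrite paddr_eq0 ?dot_ge0 ?sqr_ge0// dot_eq0 sqrf_eq0.
by case/andP=> /eqP -> /eqP ->.
Qed.

(** In R^(n+2) the image of L has codimension two, and its orthogonal complement
    contains two orthogonal vectors: the position on the sphere factor and the
    unit normal. *)
Lemma normal_space (q nu xi : ambient R n)
    (L : {linear 'rV[R]_n -> ambient R n}) :
  injective L -> q.1 != 0 -> dot q.1 nu.1 = 0 -> metric nu nu = 1 ->
  (forall v, dot q.1 (L v).1 = 0) -> (forall v, metric nu (L v) = 0) ->
  (forall v, metric xi (L v) = 0) ->
  exists s t : R, xi = (s *: q.1, 0) + t *: nu.
Proof.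
move=> injL q0 qnu nu1 qL nuL xiL.
pose flat (w : ambient R n) : 'rV[R]_(n.+1 + 1) := row_mx w.1 (w.2)%:M.
have dot_flat v w : dot (flat v) (flat w) = metric v w.
  by rewrite dot_row_mx; congr (_ + _); rewrite /dot big_ord1 !mxE.
have flatP a u v : flat (a *: u + v) = a *: flat u + flat v.
  by rewrite /flat scale_row_mx add_row_mx /= raddfD /= scale_scalar_mx.
have flat_linear : linear (flat \o L) by move=> a u v /=; rewrite linearP flatP.
pose lL := GRing.isLinear.Build _ _ _ _ (flat \o L) flat_linear.
pose LL : {linear _ -> _} := HB.pack (flat \o L) lL.
have AE v : v *m lin1_mx LL = flat (L v) by rewrite mul_rV_lin1.
have flat_eq0 w : flat w = 0 -> w = 0.
  by move=> w0; apply: metric_eq0; rewrite -dot_flat w0 dot0l.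
have pos0 w : metric (q.1, 0) w = dot q.1 w.1 by rewrite /metric /= mul0r addr0.
have [|||||v|v|v|s [t]] := @orthogonal_pair_complement R n (n.+1 + 1)
    (lin1_mx LL) (flat (q.1, 0)) (flat nu) (flat xi).
- by rewrite addn2 addn1.
- apply: inj_row_free => v; rewrite AE => /flat_eq0 Lv0; apply: injL.
  by rewrite Lv0 linear0.
- by apply: contra_neq q0 => /flat_eq0 [].
- apply/eqP => /flat_eq0 nu0; move: nu1.
  by rewrite nu0 /metric dot0l mul0r addr0 => /eqP; rewrite eq_sym oner_eq0.
- by rewrite dot_flat pos0.
- by rewrite AE dot_flat pos0.
- by rewrite AE dot_flat.
- by rewrite AE dot_flat.
- move=> E; exists s, t; apply/subr0_eq/flat_eq0.
  have -> : (s *: q.1, 0) + t *: nu = s *: (q.1, 0 : R^o) + (t *: nu + 0).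
    by rewrite addr0; congr (_ + _); congr pair; rewrite scaler0.
  rewrite addrC -scaleN1r 3!flatP E scaleN1r.
  by rewrite -[flat 0](addrK (flat 0)) -[in X in X + _ - _](scale1r (flat 0))
    -flatP addr0 scale1r subrr addr0 addNr.
Qed.

End NormalPlane.

(** * The normal field of an immersed hypersurface *)

Section Immersion.
Variables (R : realType) (n : nat) (r : R) (Sigma : manifold R n).
Variables (x nu : Sigma -> ambient R n).
Hypotheses (r0 : 0 < r) (hx : immersed_hypersurface r x).
Hypothesis hnu : unit_normal x nu.

Let cylx p : dot (x p).1 (x p).1 = r ^+ 2.
Proof. by apply/(sphereP _ (ltW r0)); have [/(_ p)[]] := hx. Qed.

Let posnu p : dot (x p).1 (nu p).1 = 0.
Proof. by case: hnu. Qed.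

Let nunu p : metric (nu p) (nu p) = 1.
Proof. by case: hnu. Qed.

Lemma position_neq0 p : (x p).1 != 0.
Proof. by rewrite -dot_eq0 cylx expf_neq0// gt_eqF. Qed.

Section AtPoint.
Variables (c : chart R n Sigma) (p : Sigma).
Hypotheses (ac : atlas c) (cp : dom c p).

Lemma is_tderive_x v : is_derive (cmap c p) v (x \o cinv c) (tderive x c p v).
Proof. by apply: is_tderive => //; case: hx. Qed.

Lemma is_tderive_nu v :
  is_derive (cmap c p) v (nu \o cinv c) (tderive nu c p v).
Proof. by apply: is_tderive => //; case: hnu. Qed.

Lemma position_tangent v : dot (x p).1 (tderive x c p v).1 = 0.
Proof.
have Dx := is_derive_fst (is_tderive_x v).
have := is_derive_dot Dx Dx.
rewrite (_ : (fun y => dot _ _) = cst (r ^+ 2)); last first.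
  by apply/funext => y /=; rewrite cylx.
move=> /is_derive_unique/(_ (is_derive_cst _ _ _)).
by rewrite /= cmapK// dotC -mulr2n => /eqP; rewrite mulrn_eq0 => /eqP.
Qed.

Lemma normal_tangent v : metric (nu p) (tderive x c p v) = 0.
Proof. by case: hnu => _ _ _; apply. Qed.

Lemma normal_derive_normal v : metric (nu p) (tderive nu c p v) = 0.
Proof.
have := is_derive_metric (is_tderive_nu v) (is_tderive_nu v).
rewrite (_ : (fun y => metric _ _) = cst 1); last first.
  by apply/funext => y /=; rewrite nunu.
move=> /is_derive_unique/(_ (is_derive_cst _ _ _)).
by rewrite /= cmapK// metricC -mulr2n => /eqP; rewrite mulrn_eq0 => /eqP.
Qed.

Lemma position_derive_normal v :
  dot (x p).1 (tderive nu c p v).1 = (nu p).2 * (tderive x c p v).2.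
Proof.
have := is_derive_dot (is_derive_fst (is_tderive_x v))
  (is_derive_fst (is_tderive_nu v)).
rewrite (_ : (fun y => dot _ _) = cst 0); last first.
  by apply/funext => y /=; rewrite posnu.
move=> /is_derive_unique/(_ (is_derive_cst _ _ _)).
rewrite /= cmapK// (dotC (tderive x c p v).1) => h.
apply: (addrI (dot (nu p).1 (tderive x c p v).1)).
by rewrite h -(normal_tangent v).
Qed.

Lemma normal_decomposition xi : (forall v, metric xi (tderive x c p v) = 0) ->
  exists s t : R, xi = (s *: (x p).1, 0) + t *: nu p.
Proof.
have sx : smooth_map x by case: hx.
have E v := tderive_diff sx v ac cp.
pose L := 'd (x \o cinv c) (cmap c p).
move=> xiL; apply: (@normal_space _ _ _ _ _ L) => //.
- move=> u v uv; have [_ _ /(_ c p ac cp)] := hx; apply.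
  by rewrite !E.
- exact: position_neq0.
- by move=> v; rewrite -E position_tangent.
- by move=> v; rewrite -E normal_tangent.
- by move=> v; rewrite -E.
Qed.

(** The covariant derivative of the normal is tangent to the cylinder and
    orthogonal to the normal, so that it vanishes with the second fundamental
    form. What is left is the component along the position on the sphere, which
    is found by differentiating <x_1, nu_1> = 0. *)
Lemma second_form0_derive_normal u : (forall v, second_form x nu c p u v = 0) ->
  tderive nu c p u =
    (((nu p).2 * (tderive x c p u).2 / r ^+ 2) *: (x p).1, 0).
Proof.
rewrite /second_form => /normal_decomposition[s [t]].
rewrite /covariant_derive /tproj /sphere_proj cylx position_derive_normal.
set D := tderive nu c p u; set k := _ / _ => E.
have E1 : D.1 - k *: (x p).1 = s *: (x p).1 + t *: (nu p).1 by case: E.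
have E2 : D.2 = t * (nu p).2 by case: E => _ ->; rewrite add0r.
have t0 : t = 0.
  have := normal_derive_normal u; rewrite -/D.
  rewrite (_ : D = ((k + s) *: (x p).1, 0) + t *: nu p).
    rewrite metricC metricDl metricZl nunu /metric /= dotZl posnu.
    by rewrite mulr0 mul0r !add0r mulr1.
  rewrite [LHS]surjective_pairing; congr pair.
    by rewrite scalerDl -addrA -E1 addrC subrK.
  by rewrite E2 /= add0r.
have s0 : s = 0.
  have := congr1 (dot (x p).1) E1.
  rewrite !dot_simpl position_derive_normal posnu cylx /k divfK ?subrr.
    move/esym/eqP; rewrite mulr0 addr0 mulf_eq0 => /orP[/eqP//|].
    by rewrite expf_eq0 /= gt_eqF.
  by rewrite expf_neq0// gt_eqF.
rewrite [LHS]surjective_pairing E2 t0 mul0r; congr pair.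
by apply/subr0_eq; rewrite E1 s0 t0 !scale0r addr0.
Qed.

End AtPoint.

(** By the count of dimensions the normal field is tau xi for a function tau
    with tau^2 = 1; differentiating this relation shows that tau, hence the
    normal field, is constant. *)
Lemma constant_unit_normal_totally_geodesic (xi : ambient R n) :
  metric xi xi = 1 -> (forall p, dot (x p).1 xi.1 = 0) ->
  (forall c p v, atlas c -> dom c p -> metric xi (tderive x c p v) = 0) ->
  totally_geodesic x nu.
Proof.
move=> xi1 posxi xitan.
pose tau p := metric (nu p) xi.
have nuE p : nu p = tau p *: xi /\ tau p * tau p = 1.
  have [c ac cp] := atlas_cover p.
  have [s [t E]] := normal_decomposition ac cp (fun v => xitan c p v ac cp).
  have s0 : s = 0.
    have := congr1 (fun w => dot (x p).1 w.1) E.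
    rewrite /= dotDr !dotZr posxi posnu cylx mulr0 addr0 => /esym/eqP.
    by rewrite mulf_eq0 expf_eq0 /= (gt_eqF r0) orbF => /eqP.
  have {}E : xi = t *: nu p.
    by rewrite E s0 scale0r [X in X + _](_ : _ = 0) ?add0r.
  have -> : tau p = t by rewrite /tau E metricC metricZl nunu mulr1.
  have tt : t * t = 1.
    by rewrite -xi1 E metricZl metricC metricZl nunu mulr1.
  by rewrite E scalerA tt scale1r.
have Dtau c p v : atlas c -> dom c p ->
    is_derive (cmap c p) v (tau \o cinv c) (metric (tderive nu c p v) xi).
  move=> ac cp; apply: is_derive_eq.
    apply: is_derive_metric (is_tderive_nu ac cp v) (is_derive_cst xi _ _).
  by rewrite /metric dot0r mulr0 !addr0.
have tau_const p q : tau p = tau q.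
  apply: (@tderive0_constant R n Sigma tau) => c z v ac cz.
  apply: is_derive_eq; first exact: Dtau.
  have := is_deriveM (Dtau c z v ac cz) (Dtau c z v ac cz).
  rewrite (_ : _ * _ = cst 1); last first.
    by apply/funext => y; have [_ <-] := nuE (cinv c y).
  move=> /is_derive_unique/(_ (is_derive_cst _ _ _)) /=.
  rewrite cmapK// -scalerDr => /eqP; rewrite scaler_eq0 => /orP[/eqP t0|].
    by have [_] := nuE z; rewrite t0 mul0r => /eqP; rewrite eq_sym oner_eq0.
  by rewrite -mulr2n mulrn_eq0 => /eqP.
move=> c p u v ac cp; rewrite /second_form /covariant_derive /tderive.
rewrite (_ : nu \o cinv c = cst (nu p)); last first.
  apply/funext => y /=; have [-> _] := nuE (cinv c y); have [-> _] := nuE p.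
  by rewrite (tau_const (cinv c y) p).
by rewrite derive_cst /tproj /sphere_proj /metric /= dot0r mul0r scale0r subrr
  dot0l mul0r addr0.
Qed.

End Immersion.

(** * Totally geodesic f-minimal hypersurfaces have a constant normal *)

Section Rigidity.
Variables (R : realType) (n : nat) (r : R) (Sigma : manifold R n).
Variables (x nu : Sigma -> ambient R n).
Hypotheses (r0 : 0 < r) (hx : immersed_hypersurface r x).
Hypothesis hnu : unit_normal x nu.

Let cylx p : dot (x p).1 (x p).1 = r ^+ 2.
Proof. by apply/(sphereP _ (ltW r0)); have [/(_ p)[]] := hx. Qed.

Lemma gradient_potential (q : ambient R n) :
  grad (@potential R n) q = (0, q.2 / 2).
Proof.
have Dp v : is_derive q v (@potential R n) (q.2 / 2 * v.2).
  have D2 := is_derive_snd (is_derive_id q v).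
  have := is_deriveZ (4^-1 : R) (is_deriveM D2 D2).
  rewrite (_ : _ \*: _ = @potential R n); last first.
    by apply/funext => w; rewrite /potential expr2 [RHS]mulrC.
  move=> D; apply: (is_derive_eq D).
  by rewrite /GRing.scale /=; field.
rewrite /grad /tproj; congr pair; last first.
  by have [_ ->] := Dp (0, 1); rewrite mulr1.
rewrite (_ : (_, _).1 = 0) /=; last first.
  by apply/rowP => i; rewrite !mxE; have [_ ->] := Dp (delta_mx 0 i, 0);
    rewrite mulr0.
by rewrite /sphere_proj dot0r mul0r scale0r subrr.
Qed.

(** The derivative of the normal is nu_h dh / r^2 times the position on the
    sphere. Its last component is zero, so nu_h is constant; f-minimality with
    H = 0 says h nu_h = 0, and the derivative of this relation, nu_h dh = 0,
    makes the remaining components constant too. *)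
Lemma totally_geodesic_constant_normal :
  f_minimal (@potential R n) x nu -> totally_geodesic x nu ->
  exists nu0, (forall p, nu p = nu0) /\ (forall p, (x p).2 * nu0.2 = 0).
Proof.
move=> fmin tg.
have xnu p : (x p).2 * (nu p).2 = 0.
  have [c ac cp] := atlas_cover p.
  have II0 : \matrix_(i < n, j < n)
      second_form x nu c p (delta_mx 0 i) (delta_mx 0 j) = 0.
    by apply/matrixP => i j; rewrite !mxE; exact: tg.
  have := fmin c p ac cp; rewrite /mean_curvature [X in _ *m X]II0.
  rewrite mulmx0 raddf0 gradient_potential /metric /= dot0l add0r mulrAC.
  by move/esym/eqP; rewrite mulf_eq0 invr_eq0 pnatr_eq0 orbF => /eqP.
have [p0 _] := manifold_nonempty Sigma.
have Dnu c p v ac cp := second_form0_derive_normal r0 hx hnu ac cp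
  (fun w => tg c p v w ac cp).
have nu2 p : (nu p).2 = (nu p0).2.
  apply: (@tderive0_constant R n Sigma (fun p => (nu p).2)) => c q v ac cq.
  apply: is_derive_eq; first exact: is_derive_snd (is_tderive_nu hnu ac cq v).
  by rewrite Dnu.
have xnu2 c p v : atlas c -> dom c p -> (nu p).2 * (tderive x c p v).2 = 0.
  move=> ac cp.
  have := is_deriveZ (nu p0).2 (is_derive_snd (is_tderive_x hx ac cp v)).
  rewrite (_ : _ \*: _ = cst 0); last first.
    by apply/funext => y /=; rewrite -(nu2 (cinv c y)) [LHS]mulrC xnu.
  by move=> /is_derive_unique/(_ (is_derive_cst _ _ _)); rewrite nu2.
exists (nu p0); split=> p; last by rewrite -(nu2 p) xnu.
rewrite [LHS]surjective_pairing [RHS]surjective_pairing nu2; congr pair.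
apply/rowP => j.
apply: (@tderive0_constant R n Sigma (fun p => (nu p).1 0 j)) => c q v ac cq.
apply: is_derive_eq.
  exact: is_derive_coord (is_derive_fst (is_tderive_nu hnu ac cq v)).
by rewrite Dnu//= xnu2// mul0r scale0r mxE.
Qed.

End Rigidity.

(** * The range of a properly immersed hypersurface with constant normal *)

Section Range.
Variables (R : realType) (n : nat) (r : R) (Sigma : manifold R n).
Variables (x nu : Sigma -> ambient R n).
Hypotheses (r0 : 0 < r) (hx : immersed_hypersurface r x).
Hypothesis hnu : unit_normal x nu.

Let cylx p : dot (x p).1 (x p).1 = r ^+ 2.
Proof. by apply/(sphereP _ (ltW r0)); have [/(_ p)[]] := hx. Qed.

(** The inverse image of K is compact, and outside of it f exceeds its value at
    p0. *)
Lemma proper_attains_min (f : ambient R n -> R^o) (K : set (ambient R n)) p0 :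
  properly_immersed r x -> K `<=` cylinder r -> compact K -> continuous f ->
  (forall p, f (x p) <= f (x p0) -> K (x p)) ->
  exists p, forall q, f (x p) <= f (x q).
Proof.
move=> px Kr cK cf fK.
have cx : continuous x by case: hx => _ sx _; exact: smooth_map_continuous sx.
have [||p _ pmin] := compact_EVT_min (f := f \o x) _ (px K Kr cK).
- by exists p0; exact: fK.
- apply: continuous_subspaceT => p.
  by apply: continuous_comp; [exact: cx|exact: cf].
exists p => q; have [qK|qK] := pselect (K (x q)).
  by apply: pmin; rewrite inE.
have p0K : p0 \in x @^-1` K by rewrite inE; exact: fK.
apply: (le_trans (pmin _ p0K)); rewrite leNgt; apply/negP => /ltW.
by move/fK.
Qed.

(** An immersion over a single point of the sphere would have only vertical
    tangent vectors, and these span a space of dimension one. *)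
Lemma position_not_constant (y : 'rV[R]_n.+1) : (2 <= n)%N ->
  exists p, (x p).1 != y.
Proof.
move=> n2; apply/not_existsP => xy.
have {}xy p : (x p).1 = y by have /negP := xy p; rewrite negbK => /eqP.
have [p _] := manifold_nonempty Sigma; have [c ac cp] := atlas_cover p.
have dx1 v : (tderive x c p v).1 = 0.
  have := is_derive_fst (is_tderive_x hx ac cp v).
  rewrite (_ : (fun z => _) = cst y); last by apply/funext => z /=; rewrite xy.
  by move=> /is_derive_unique/(_ (is_derive_cst _ _ _)).
have sx : smooth_map x by case: hx.
have E v := tderive_diff sx v ac cp.
pose h (v : 'rV[R]_n) : R := (tderive x c p v).2.
(* The differential of the height is a linear form, so it has a kernel. *)
pose g : 'rV[R]_n := \row_j h (delta_mx 0 j).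
have hE v : h v = dot g v.
  rewrite /h E [v in LHS]row_sum_delta linear_sum /= raddf_sum /=.
  apply: eq_bigr => j _; rewrite linearZ_LR /= -E !mxE.
  by rewrite [LHS]mulrC.
have [w w0 gw] := ex_orthogonal_neq0 g n2.
have /eqP[] := w0; have [_ _ /(_ c p ac cp)] := hx; apply.
rewrite {2}/tderive derive0 [LHS]surjective_pairing dx1; congr pair.
by rewrite -/(h w) hE.
Qed.

Definition weighted_dist2 (K : R) (q w : ambient R n) : R^o :=
  dot (w.1 - q.1) (w.1 - q.1) + K * (w.2 - q.2) ^+ 2.

Lemma weighted_dist2_continuous K q : continuous (weighted_dist2 K q).
Proof.
move=> w; apply: cvgD.
  by apply: cvg_dot; (apply: cvgB; [exact: cvg_fst|exact: cvg_cst]).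
apply: cvgM; first exact: cvg_cst.
under eq_fun do rewrite expr2.
by apply: cvgM; (apply: cvgB; [exact: cvg_snd|exact: cvg_cst]).
Qed.

Lemma weighted_dist2_critical K q p :
  (forall z, weighted_dist2 K q (x p) <= weighted_dist2 K q (x z)) ->
  forall c v, atlas c -> dom c p ->
  metric ((x p).1 - q.1, K * ((x p).2 - q.2)) (tderive x c p v) = 0.
Proof.
move=> pmin c v ac cp.
have Df z : dom c z -> is_derive (cmap c z) v
    (weighted_dist2 K q \o x \o cinv c)
    (2 * metric ((x z).1 - q.1, K * ((x z).2 - q.2)) (tderive x c z v)).
  move=> cz; have Dx := is_tderive_x hx ac cz v.
  have D1 := is_deriveB (is_derive_fst Dx) (is_derive_cst q.1 _ _).
  have D2 := is_deriveB (is_derive_snd Dx) (is_derive_cst q.2 _ _).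
  have := is_deriveD (is_derive_dot D1 D1) (is_deriveZ K (is_deriveM D2 D2)).
  rewrite (_ : _ + _ = weighted_dist2 K q \o x \o cinv c); last first.
    by apply/funext => y; rewrite /= /weighted_dist2 expr2.
  move=> D; apply: (is_derive_eq D).
  rewrite /= !fctE /= cmapK// !subr0 /metric /GRing.scale /=.
  by rewrite (dotC (tderive _ _ _ _).1); ring.
have := derive_at_min (f := weighted_dist2 K q \o x \o cinv c)
  (a := cmap c p) (v := v).
have [_ ->] := Df p cp => D0.
apply: (@mulfI _ 2); first by rewrite pnatr_eq0.
rewrite mulr0; apply: D0.
  by apply: filterS (nbhs_cod cp) => _ [z cz <-]; have [] := Df z cz.
by move=> y /=; rewrite cmapK.
Qed.

(** The critical points of the weighted distance to a point q of the slice lie at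
    the height of q and over q or its antipode; giving a small weight to the
    height, the minimum is smaller than the squared distance of antipodal
    points. *)
Lemma range_constant_normal nu0 : (2 <= n)%N -> properly_immersed r x ->
  (forall p, nu p = nu0) -> (forall p, (x p).2 * nu0.2 = 0) ->
  range x = [set q | [/\ sphere r q.1, dot q.1 nu0.1 = 0 & q.2 * nu0.2 = 0]].
Proof.
move=> n2 px nuE xnu2.
have r00 := ltW r0.
have posnu p : dot (x p).1 nu0.1 = 0 by rewrite -(nuE p); case: hnu.
apply/seteqP; split=> [_ [p _ <-]|q [/(sphereP _ r00) qr qnu qnu2]].
  by split=> //; apply/sphereP.
have [p0 p0q] := position_not_constant (- q.1) n2.
(* By the parallelogram law this squared norm is what is missing to the squared
   distance from q.1 to be that of antipodal points, 4 r^2. *)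
have d0 : 0 < dot ((x p0).1 + q.1) ((x p0).1 + q.1).
  by rewrite lt_def dot_ge0 dot_eq0 addr_eq0 p0q.
set d := dot _ _ in d0.
have xq p : dot ((x p).1 - q.1) ((x p).1 - q.1) =
    4 * r ^+ 2 - dot ((x p).1 + q.1) ((x p).1 + q.1).
  by rewrite !dot_simpl cylx qr (dotC q.1); ring.
pose h2 : R := ((x p0).2 - q.2) ^+ 2.
have h20 : 0 <= h2 by exact: sqr_ge0.
(* With this weight the height contributes less than d at p0. *)
pose K := d / (2 * (1 + h2)).
have K0 : 0 < K by rewrite divr_gt0// mulr_gt0// ltr_wpDr.
have fp0 : weighted_dist2 K q (x p0) < 4 * r ^+ 2.
  rewrite /weighted_dist2 xq -/d -/h2.
  suff : K * h2 < d by move=> ?; lra.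
  rewrite /K mulrAC ltr_pdivrMr; last by rewrite mulr_gt0// ltr_wpDr.
  by rewrite ltr_pM2l//; lra.
(* Beyond this height difference the weighted distance exceeds its value at
   p0. *)
pose L := Num.sqrt (weighted_dist2 K q (x p0) / K).
have [|||p pmin] := @proper_attains_min (weighted_dist2 K q)
  (sphere r `*` `[q.2 - L, q.2 + L]) p0 px _ _ (@weighted_dist2_continuous K q).
- by move=> w [].
- by apply: compact_setX; [exact: compact_sphere|exact: segment_compact].
- move=> p pp0; split=> /=; first exact/sphereP.
  rewrite in_itv /= -ler_distlC distrC -sqrtr_sqr ler_sqrt; last first.
    apply: divr_ge0 (ltW K0); apply: addr_ge0; first exact: dot_ge0.
    exact: mulr_ge0 (ltW K0) (sqr_ge0 _).
  rewrite ler_pdivlMr// mulrC; apply: le_trans pp0.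
  by rewrite lerDr dot_ge0.
have [c ac cp] := atlas_cover p.
have [s [t]] := normal_decomposition r0 hx hnu ac cp
  (fun v => weighted_dist2_critical pmin v ac cp).
rewrite nuE => E.
have E1 : (x p).1 - q.1 = s *: (x p).1 + t *: nu0.1 by case: E.
have E2 : K * ((x p).2 - q.2) = t * nu0.2 by case: E => _ ->; rewrite add0r.
(* The left-hand side of E is orthogonal to nu0, as both x p and q lie in the
   slice. *)
have t0 : t = 0.
  have := congr1 (fun w => metric w nu0) E.
  rewrite /= metricDl metricZl (_ : metric nu0 nu0 = 1); last first.
    by rewrite -(nuE p); case: hnu.
  rewrite /metric /= dotZl dotBl posnu qnu -mulrA mulrBl xnu2 qnu2.
  by rewrite !subrr !mulr0 mul0r !add0r mulr1.
have x2 : (x p).2 = q.2.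
  apply/subr0_eq/(mulfI (lt0r_neq0 K0)).
  by rewrite mulr0 E2 t0 mul0r.
have {E1}q1 : q.1 = (1 - s) *: (x p).1.
  by rewrite scalerBl scale1r -[s *: _]addr0 -[0](scale0r nu0.1) -t0 -E1 subKr.
have : (1 - s) ^+ 2 = 1.
  apply: (mulIf (expf_neq0 2 (lt0r_neq0 r0))).
  by rewrite mul1r -[in RHS]qr q1 !dot_simpl cylx expr2 mulrA.
move/eqP; rewrite sqrf_eq1 => /orP[|] /eqP s1.
  exists p => //; rewrite [LHS]surjective_pairing [RHS]surjective_pairing x2.
  by rewrite q1 s1 scale1r.
(* At the antipode the minimum would be 4 r^2. *)
have := le_lt_trans (pmin p0) fp0.
rewrite /weighted_dist2 xq x2 q1 s1 scaleN1r !subrr.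
by rewrite dot0l expr0n /= mulr0 subr0 addr0 ltxx.
Qed.

End Range.

(** * Totally geodesic spheres are hyperplane sections *)

Section GreatCircle.
Variables (R : realType) (k : nat).
Implicit Types y w : 'rV[R]_k.

Definition circle y w (t : R) : 'rV[R]_k := cos t *: y + sin t *: w.

Lemma is_derive_circle y w (t : R) :
  is_derive t 1 (circle y w) (- sin t *: y + cos t *: w).
Proof.
have Dz (f : R -> R) (df : R) (z : 'rV[R]_k) :
    is_derive t 1 f df -> is_derive t 1 (fun s => f s *: z) (df *: z).
  move=> Df; pose L := fun s : R => s *: z.
  have Lz : linear L by move=> a b c; rewrite /L scalerDl scalerA.
  pose LL : {linear R^o -> 'rV[R]_k} :=
    HB.pack L (GRing.isLinear.Build _ _ _ _ L Lz).
  apply: (@is_derive_linear R R R^o _ LL f) => //.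
  exact: scalel_continuous.
exact: is_deriveD (Dz _ _ y (is_derive_cos t)) (Dz _ _ w (is_derive_sin t)).
Qed.

Lemma circle_sphere y w r t : dot y y = r ^+ 2 -> dot w w = r ^+ 2 ->
  dot y w = 0 -> dot (circle y w t) (circle y w t) = r ^+ 2.
Proof.
move=> yy ww yw; rewrite /circle !dot_simpl (dotC w) yy ww yw.
by rewrite -[RHS]mulr1 -(cos2Dsin2 t); ring.
Qed.

Lemma circle_tangent y w r t : dot y y = r ^+ 2 -> dot w w = r ^+ 2 ->
  dot y w = 0 -> dot (circle y w t) (- sin t *: y + cos t *: w) = 0.
Proof.
by move=> yy ww yw; rewrite /circle !dot_simpl (dotC w) yy ww yw; ring.
Qed.

Lemma scale_to_sphere y r : y != 0 -> 0 < r ->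
  exists2 a : R, 0 < a & dot (a *: y) (a *: y) = r ^+ 2.
Proof.
rewrite -dot_eq0 => y0 r0; have yy : 0 < dot y y by rewrite lt_def y0 dot_ge0.
exists (r / Num.sqrt (dot y y)); first by rewrite divr_gt0 ?sqrtr_gt0.
rewrite !dot_simpl mulrA -expr2 expr_div_n sqr_sqrtr ?ltW//.
by rewrite divfK.
Qed.

(** The circle leaves y in the direction of the projection of z to y^perp. This
    projection vanishes when z is y or its antipode; the bound on k then
    provides another direction. *)
Lemma ex_circle y z r : (2 <= k)%N -> 0 < r ->
  dot y y = r ^+ 2 -> dot z z = r ^+ 2 ->
  exists w t, [/\ dot w w = r ^+ 2, dot y w = 0 & z = circle y w t].
Proof.
move=> k2 r0 yy zz; have r2 : r ^+ 2 != 0 by rewrite expf_neq0// gt_eqF.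
pose a := dot y z / r ^+ 2; pose z' := z - a *: y.
have yz' : dot y z' = 0 by rewrite !dot_simpl yy /a divfK// subrr.
have z'z' : dot z' z' = (1 - a ^+ 2) * r ^+ 2.
  rewrite /z' !dot_simpl yy zz (dotC z) (_ : dot y z = a * r ^+ 2).
    by ring.
  by rewrite /a divfK.
have [z'0|z'0] := eqVneq z' 0; last first.
  have a1 : 0 < 1 - a ^+ 2.
    rewrite -(pmulr_lgt0 _ (exprn_gt0 2 r0)) -z'z' lt_def dot_ge0.
    by rewrite dot_eq0 z'0.
  have ab : -1 <= a <= 1 by apply/andP; split; nra.
  exists ((Num.sqrt (1 - a ^+ 2))^-1 *: z'), (acos a); split.
  - rewrite !(dotZl, dotZr) z'z' mulrA -expr2 exprVn sqr_sqrtr ?ltW//.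
    by rewrite mulKf// gt_eqF.
  - by rewrite dotZr yz' mulr0.
  rewrite /circle acosK ?in_itv//= sin_acos// scalerA divff ?scale1r.
    by rewrite addrC subrK.
  by rewrite gt_eqF// sqrtr_gt0.
(* Any circle through y will do. *)
have [w0 w0n yw0] := ex_orthogonal_neq0 y k2.
have [b b0 bw] := scale_to_sphere w0n r0.
have za : z = a *: y by apply/subr0_eq.
have : a ^+ 2 = 1.
  apply: (mulIf r2); rewrite mul1r -[in RHS]zz za !dot_simpl yy.
  by rewrite expr2 mulrA.
have yw : dot y (b *: w0) = 0 by rewrite dotZr yw0 mulr0.
move/eqP; rewrite sqrf_eq1 => /orP[|] /eqP a1.
  exists (b *: w0), 0; split=> //.
  by rewrite /circle cos0 sin0 scale0r addr0 za a1.
exists (b *: w0), pi; split=> //.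
by rewrite /circle cospi sinpi scale0r addr0 za a1.
Qed.

(** F and G may be arbitrary away from the sphere, so the relation is
    differentiated along the great circle with velocity proportional to v. *)
Lemma derive_dot_sphere m (F G : 'rV[R]_k -> 'rV[R]_m) (a r : R) y v :
  0 < r -> differentiable F y -> differentiable G y ->
  (forall z, dot z z = r ^+ 2 -> dot (F z) (G z) = a) ->
  dot y y = r ^+ 2 -> dot y v = 0 ->
  dot ('D_v F y) (G y) + dot (F y) ('D_v G y) = 0.
Proof.
move=> r0 dF dG FG yy yv.
have [->|v0] := eqVneq v 0; first by rewrite !derive0 dot0l dot0r addr0.
have [b b0 bv] := scale_to_sphere v0 r0.
have ybv : dot y (b *: v) = 0 by rewrite dotZr yv mulr0.
have c0 : circle y (b *: v) 0 = y.
  by rewrite /circle cos0 sin0 scale1r scale0r addr0.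
have Dc := is_derive_circle y (b *: v) 0.
rewrite cos0 sin0 oppr0 scale0r add0r scale1r in Dc.
have dFc : differentiable F (circle y (b *: v) 0) by rewrite c0.
have dGc : differentiable G (circle y (b *: v) 0) by rewrite c0.
have := is_derive_dot (is_derive_comp dFc Dc) (is_derive_comp dGc Dc).
rewrite (_ : (fun t => dot _ _) = cst a); last first.
  by apply/funext => t /=; rewrite FG//; exact: circle_sphere.
move=> /is_derive_unique/(_ (is_derive_cst _ _ _)) /=; rewrite c0.
have DZ (H : 'rV[R]_k -> 'rV[R]_m) : differentiable H y ->
    'D_(b *: v) H y = b *: 'D_v H y.
  by move=> dH; rewrite !deriveE// linearZ_LR.
rewrite (DZ F dF) (DZ G dG) dotZl dotZr -mulrDr => /eqP.
by rewrite mulf_eq0 gt_eqF//= => /eqP.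
Qed.

End GreatCircle.

(** The derivative of the unit normal N is orthogonal to N, to the position and,
    as the second fundamental form vanishes, to the tangent space; so it is
    zero, and N has the same value at all points of the great circles through a
    given point. *)
Lemma totally_geodesic_sphere_orthogonal (R : realType) (n : nat) (r : R)
    (S : set 'rV[R]_n.+1) :
  (2 <= n)%N -> 0 < r -> totally_geodesic_sphere r S ->
  exists2 N0, dot N0 N0 = 1 & forall z, S z -> dot z N0 = 0.
Proof.
move=> n2 r0 [U [i [N [[oU sU si sN] [_ <- iN Ni II]]]]].
have sphE k (y : 'rV[R]_k) : sphere r y <-> dot y y = r ^+ 2.
  exact/sphereP/ltW.
have di y : dot y y = r ^+ 2 -> differentiable i y.
  by move=> /sphE/sU Uy; exact: (si [::]).
have dN y : dot y y = r ^+ 2 -> differentiable N y.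
  by move=> /sphE/sU Uy; exact: (sN [::]).
have ii y : dot y y = r ^+ 2 -> dot (i y) (i y) = r ^+ 2.
  by move=> /sphE/iN[/sphE].
have iN0 y : dot y y = r ^+ 2 -> dot (i y) (N y) = 0 by move=> /sphE/iN[].
have NN y : dot y y = r ^+ 2 -> dot (N y) (N y) = 1 by move=> /sphE/iN[].
have r2 : r ^+ 2 != 0 by rewrite expf_neq0// gt_eqF.
have parallel y v : dot y y = r ^+ 2 -> dot y v = 0 -> 'D_v N y = 0.
  move=> yy yv; have ys : sphere r y by apply/sphE.
  have iDN : dot (i y) ('D_v N y) = 0.
    have := derive_dot_sphere r0 (di y yy) (dN y yy) iN0 yy yv.
    by rewrite dotC Ni// add0r.
  have NDN : dot (N y) ('D_v N y) = 0.
    have := derive_dot_sphere r0 (dN y yy) (dN y yy) NN yy yv.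
    by rewrite dotC -mulr2n => /eqP; rewrite mulrn_eq0 => /eqP.
  have iDi u : dot y u = 0 -> dot (i y) ('D_u i y) = 0.
    move=> yu; have := derive_dot_sphere r0 (di y yy) (di y yy) ii yy yu.
    by rewrite dotC -mulr2n => /eqP; rewrite mulrn_eq0 => /eqP.
  (* The rows of this matrix span the tangent space of the source sphere. *)
  pose K := kermx y^T.
  pose T (u : 'rV[R]_(\rank K)) := u *m row_base K.
  have yT u : dot y (T u) = 0.
    rewrite dotC dotE; have : (T u <= K)%MS.
      by rewrite (submx_trans (submxMl _ _))// eq_row_base.
    by move=> /sub_kermxP ->; rewrite mxE.
  pose A := row_base K *m lin1_mx ('d i y).
  have AE u : u *m A = 'D_(T u) i y.
    by rewrite /A mulmxA mul_rV_lin1 deriveE//; exact: di.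
  have y0 : y != 0 by rewrite -dot_eq0 yy.
  have [|||||u|u|u|s [t DN]] := @orthogonal_pair_complement R (\rank K) n.+1 A
    (i y) (N y) ('D_v N y).
  - rewrite mxrank_ker mxrank_tr rank_rV y0 /=.
    by case: (n) n2 => // m _; rewrite subn1 addn2.
  - apply: inj_row_free => u; rewrite AE => DT0.
    have [+ _] := II y (T u) (T u) ys (yT u) (yT u).
    rewrite DT0 dot0l => /esym/eqP; rewrite dot_eq0 /T.
    rewrite -[X in _ == X](mul0mx _ (row_base K)).
    by move/eqP/(row_free_inj (row_base_free K)).
  - by rewrite -dot_eq0 ii.
  - by rewrite -dot_eq0 NN// oner_eq0.
  - exact: iN0.
  - by rewrite AE iDi.
  - by rewrite AE Ni.
  - rewrite AE; have [_] := II y v (T u) ys yv (yT u).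
    by rewrite /sphere_proj iDN mul0r scale0r subr0.
  - have : s * r ^+ 2 = 0.
      by rewrite -iDN DN !dot_simpl ii// iN0// mulr0 addr0.
    have : t = 0.
      by rewrite -NDN DN !dot_simpl NN// dotC iN0// mulr0 add0r mulr1.
    move=> t0 /eqP; rewrite mulf_eq0 (negbTE r2) orbF => /eqP s0.
    by rewrite DN s0 t0 !scale0r addr0.
have [y yy] : exists y : 'rV[R]_n, dot y y = r ^+ 2.
  have [w w0 _] := ex_orthogonal_neq0 (0 : 'rV[R]_n) n2.
  by have [a _ aw] := scale_to_sphere w0 r0; exists (a *: w).
exists (N y); first exact: NN.
move=> _ [z /sphE zz <-]; rewrite -(iN0 z zz); congr (dot _ _).
have [w [t [ww yw ->]]] := ex_circle n2 r0 yy zz.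
have c0 : circle y w 0 = y by rewrite /circle cos0 sin0 scale1r scale0r addr0.
rewrite -[in LHS]c0; apply/rowP => j.
apply: (is_derive_0_is_cst (f := fun s => N (circle y w s) 0 j)) => s.
have cs := circle_sphere s yy ww yw.
have := is_derive_coord j (is_derive_comp (dN _ cs) (is_derive_circle y w s)).
by rewrite parallel ?mxE//; exact: circle_tangent yy ww yw.
Qed.

Section LinearSmooth.
Variables (R : realType) (k m : nat).

Lemma linear_row_continuous (L : {linear 'rV[R]_k -> 'rV[R]_m}) : continuous L.
Proof.
have LE : (L : _ -> _) = fun z : 'rV[R]_k => \sum_j z 0 j *: L (delta_mx 0 j).
  apply/funext => z; rewrite [in LHS](row_sum_delta z) linear_sum.
  by apply: eq_bigr => j _; exact: linearZ_LR.
rewrite LE => y.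
apply: (@cvg_big _ _ _ _ _ _ _ (nbhs y)) => [|j _].
- exact: add_continuous.
- by apply: cvgZr_tmp; exact: coord_continuous.
Qed.

Lemma derive_linear_row (L : {linear 'rV[R]_k -> 'rV[R]_m}) v y :
  'D_v L y = L v.
Proof.
have cL := @linear_row_continuous L.
rewrite deriveE; last exact: linear_differentiable.
by rewrite diff_lin.
Qed.

Lemma smooth_on_cst (U : set 'rV[R]_k) (a : 'rV[R]_m) : smooth_on U (cst a).
Proof.
move=> vs y _; suff [b ->] : exists b, iter_derive (cst a) vs = cst b.
  exact: differentiable_cst.
elim: vs => [|v vs [b IH]]; first by exists a.
by exists 0; rewrite /= IH; apply/funext => z; rewrite derive_cst.
Qed.

Lemma smooth_on_linear (U : set 'rV[R]_k) (L : {linear 'rV[R]_k -> 'rV[R]_m}) :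
  smooth_on U L.
Proof.
move=> vs y Uy; case: (lastP vs) => [|{}vs v].
  by apply: linear_differentiable; exact: linear_row_continuous.
rewrite /iter_derive foldr_rcons (_ : (fun z => _) = cst (L v)).
  exact: (@smooth_on_cst U (L v) vs y Uy).
by apply/funext => z; exact: derive_linear_row.
Qed.

End LinearSmooth.

(** A hyperplane N0^perp is parametrized isometrically by the reflection that
    exchanges N0 with the first vector of the canonical basis. When these two
    vectors coincide the quotient below is zero and the reflection is the
    identity, as it should be. *)
Lemma ex_isometry_orthogonal (R : realType) (n : nat) (N0 : 'rV[R]_n.+1) :
  dot N0 N0 = 1 ->
  exists L : {linear 'rV[R]_n -> 'rV[R]_n.+1},
    [/\ forall u v, dot (L u) (L v) = dot u v,
        forall u, dot (L u) N0 = 0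
      & forall z, dot z N0 = 0 -> exists u, L u = z].
Proof.
move=> N01; pose e : 'rV[R]_(1 + n) := row_mx 1 0.
have [w wE] : exists w : 'rV[R]_(1 + n), w = e - N0 by exists (e - N0).
pose a (v : 'rV[R]_(1 + n)) := 2 * dot v w / dot w w.
pose H (v : 'rV[R]_(1 + n)) := v - a v *: w.
have ee : dot e e = 1.
  by rewrite dot_row_mx dot0l addr0 /dot big_ord1 !mxE mulr1.
have aw v : a v * dot w w = 2 * dot v w.
  have [w0|w0] := eqVneq w 0; first by rewrite w0 !dot0r !mulr0.
  by rewrite /a divfK// dot_eq0.
have HH u v : dot (H u) (H v) = dot u v.
  have auv : a v * dot u w = a u * dot v w by rewrite /a; ring.
  transitivity
    (dot u v - a v * dot u w - a u * dot v w + a u * (a v * dot w w)).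
    by rewrite /H !(dotBl, dotBr, dotZl, dotZr) (dotC w v); ring.
  by rewrite aw auv; ring.
have aH v : a (H v) = - a v.
  rewrite /a /H dotBl dotZl aw /a; ring.
have HK v : H (H v) = v by rewrite {1}/H aH scaleNr opprK /H subrK.
have He : H e = N0.
  have ww : dot w w = 2 * dot e w.
    by rewrite wE !(dotBl, dotBr) ee (dotC N0) N01; ring.
  have [w0|w0] := eqVneq w 0.
    by rewrite /H w0 scaler0 subr0; apply/subr0_eq; rewrite -wE.
  by rewrite /H /a -ww divff ?dot_eq0// scale1r wE opprB addrC subrK.
have e0 u : dot (row_mx (0 : 'rV[R]_1) u : 'rV[R]_(1 + n)) e = 0.
  by rewrite dot_row_mx dot0l dot0r addr0.
pose L (u : 'rV[R]_n) : 'rV[R]_n.+1 := H (row_mx 0 u).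
have Llin : linear L.
  move=> b u v; rewrite /L.
  have -> : row_mx (0 : 'rV[R]_1) (b *: u + v) = b *: row_mx 0 u + row_mx 0 v.
    by rewrite scale_row_mx add_row_mx scaler0 addr0.
  rewrite /H (_ : a _ = b * a (row_mx 0 u) + a (row_mx 0 v)).
    by rewrite scalerDl -scalerA scalerBr opprD addrACA.
  by rewrite /a dotDl dotZl; ring.
pose LL : {linear 'rV[R]_n -> 'rV[R]_n.+1} :=
  HB.pack L (GRing.isLinear.Build _ _ _ _ L Llin).
exists LL; split=> [u v|u|z zN].
- by rewrite [LHS]HH dot_row_mx dot0l add0r.
- by rewrite -He [LHS]HH e0.
- exists (rsubmx (H z : 'rV[R]_(1 + n))).
  have : dot (H z) e = 0 by rewrite -HH HK He.
  move=> Hz; apply: etrans (HK z); move: Hz; rewrite /= /L; move: (H z) => y.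
  rewrite -{1 3}(hsubmxK y) dot_row_mx dot0r addr0 => y0.
  congr (H (row_mx _ _)).
  apply/rowP => j; rewrite ord1 [LHS]mxE -[LHS]y0 /dot big_ord1.
  by rewrite [X in _ * X]mxE mulr1.
Qed.

Lemma totally_geodesic_hyperplane_section (R : realType) (n : nat) (r : R)
    (N0 : 'rV[R]_n.+1) : 0 < r -> dot N0 N0 = 1 ->
  totally_geodesic_sphere r [set z | sphere r z /\ dot z N0 = 0].
Proof.
move=> r0 /[dup] N01 /ex_isometry_orthogonal[L [LL LN Lsurj]].
have sphE k (y : 'rV[R]_k) : sphere r y <-> dot y y = r ^+ 2.
  exact/sphereP/ltW.
exists setT, L, (cst N0); split.
  by split; [exact: openT|by []|exact: smooth_on_linear|exact: smooth_on_cst].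
split.
- move=> y z _ _ Lyz; apply/subr0_eq/eqP.
  by rewrite -dot_eq0 -LL raddfB /= Lyz subrr dot0l.
- apply/seteqP; split=> [_ [y /sphE yy <-]|z [/sphE zz zN]].
    by split; [apply/sphE; rewrite LL|exact: LN].
  have [y Ly] := Lsurj z zN; exists y => //.
  by apply/sphE; rewrite -LL Ly.
- by move=> y /sphE yy; split; [apply/sphE; rewrite LL|exact: LN|].
- by move=> y u _ _; rewrite derive_linear_row dotC LN.
- move=> y u v _ _ _; rewrite !derive_linear_row LL derive_cst; split=> //.
  by rewrite /sphere_proj dot0r mul0r scale0r subrr dot0l.
Qed.

(** * The classification *)

Theorem theorem3 (R : realType) (n : nat) (hn : (2 <= n)%N)
    (r : R) (hr : r = Num.sqrt (2 * (n%:R - 1)))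
    (Sigma : manifold R n) (x nu : Sigma -> ambient R n)
    (hx : immersed_hypersurface r x) (hnu : unit_normal x nu)
    (hcomplete : complete_hypersurface x)
    (hproper : properly_immersed r x)
    (hmin : f_minimal (@potential R n) x nu) :
  totally_geodesic x nu <->
    range x = @sphere R n.+1 r `*` [set 0] \/
    exists2 S, totally_geodesic_sphere r S & range x = S `*` setT.
Proof.
have r0 : 0 < r.
  by rewrite hr sqrtr_gt0 mulr_gt0// subr_gt0 -[1]/(1%:R) ltr_nat.
split=> [tg|[rx|[S tgS rx]]].
- have [nu0 [nuE xnu2]] := totally_geodesic_constant_normal r0 hx hnu hmin tg.
  have rx := range_constant_normal r0 hx hnu hn hproper nuE xnu2.
  have [p0 _] := manifold_nonempty Sigma.
  have nu1 : dot nu0.1 nu0.1 + nu0.2 * nu0.2 = 1.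
    by rewrite -(nuE p0); have [_ _ /(_ p0)] := hnu.
  have [nu2|nu2] := eqVneq nu0.2 0.
    right; exists [set z | sphere r z /\ dot z nu0.1 = 0].
      apply: totally_geodesic_hyperplane_section => //.
      by rewrite -nu1 nu2 mul0r addr0.
    rewrite rx nu2; apply/seteqP; split=> q /=.
      by move=> [? ? _].
    by move=> [[? ?] _]; split=> //; rewrite mulr0.
  have x2 p : (x p).2 = 0.
    by have /eqP := xnu2 p; rewrite mulf_eq0 (negbTE nu2) orbF => /eqP.
  (* As the height is constant, (nu0.1, 0) is a normal vector as well. *)
  have nu10 : nu0.1 = 0.
    have [c ac cp] := atlas_cover p0.
    have dx2 v : (tderive x c p0 v).2 = 0.
      have := is_derive_snd (is_tderive_x hx ac cp v).
      rewrite (_ : (fun z => _) = cst 0); last first.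
        by apply/funext => z /=; rewrite x2.
      by move=> /is_derive_unique/(_ (is_derive_cst _ _ _)).
    have [v|s [t E]] := normal_decomposition r0 hx hnu ac cp (xi := (nu0.1, 0)).
      rewrite -(normal_tangent hnu ac cp v) nuE /metric /= dx2.
      by rewrite !mulr0.
    have t0 : t = 0.
      have /esym/eqP := congr1 snd E.
      by rewrite /= add0r nuE mulf_eq0 (negbTE nu2) orbF => /eqP.
    have E1 : nu0.1 = s *: (x p0).1.
      by have := congr1 fst E; rewrite /= t0 scale0r addr0.
    apply/eqP; rewrite -dot_eq0 {1}E1 dotZl -(nuE p0).
    by case: hnu => _ -> _ _; rewrite mulr0.
  left; rewrite rx nu10; apply/seteqP; split=> q /=.
    by move=> [? _ /eqP]; rewrite mulf_eq0 (negbTE nu2) orbF => /eqP.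
  by move=> [? ->]; rewrite dot0r mul0r.
- have x2 p : (x p).2 = 0.
    by have : range x (x p) by [exists p]; rewrite rx => -[].
  apply: (constant_unit_normal_totally_geodesic r0 hx hnu (xi := (0, 1))).
  + by rewrite /metric /= dot0l mulr1 add0r.
  + by move=> p; rewrite dot0r.
  + move=> c p v ac cp; rewrite /metric /= dot0l mul1r add0r.
    have := is_derive_snd (is_tderive_x hx ac cp v).
    rewrite (_ : (fun z => _) = cst 0); last first.
      by apply/funext => z /=; rewrite x2.
    by move=> /is_derive_unique/(_ (is_derive_cst _ _ _)).
- have [N0 N01 SN0] := totally_geodesic_sphere_orthogonal hn r0 tgS.
  have xN0 p : dot (x p).1 N0 = 0.
    by apply: SN0; have : range x (x p) by [exists p]; rewrite rx => -[].
  apply: (constant_unit_normal_totally_geodesic r0 hx hnu (xi := (N0, 0))).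
  + by rewrite /metric /= mulr0 addr0.
  + exact: xN0.
  + move=> c p v ac cp; rewrite /metric /= mul0r addr0.
    have := is_derive_dot (is_derive_fst (is_tderive_x hx ac cp v))
      (is_derive_cst N0 _ _).
    rewrite (_ : (fun z => _) = cst 0); last first.
      by apply/funext => z /=; rewrite xN0.
    move=> /is_derive_unique/(_ (is_derive_cst _ _ _)).
    by rewrite dot0r addr0 dotC.
Qed.
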